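(* Let $H$ and $K$ be two commensurable subgroups of a group $G$ and let $H$ be normal in $G$. Then the quotient group $G/H$ has (RD) if and only if the Hecke pair $(G,K)$ has (RD).
   Context: All groups are discrete. Two subgroups $H,K$ of a group $G$ are commensurable if there is some $g\in G$ such that $H\cap gKg^{-1}$ has finite index in both $H$ and $gKg^{-1}$. A subgroup $H\leq G$ is almost normal if every double coset $HgH$ ($g\in G$) is a union of finitely many left cosets of $H$; then $(G,H)$ is called a Hecke pair. (A subgroup commensurable with an almost normal subgroup is almost normal.) A length function on $G$ is a map $L:G\to[0,\infty)$ with $L(1)=0$, $L(g^{-1})=L(g)$ and $L(gh)\leq L(g)+L(h)$ for all $g,h\in G$; put $N_L=\{g\in G: L(g)=0\}$. A length function on a Hecke pair $(G,H)$ is a length function $L$ on $G$ with $H\subseteq N_L$ (so $L$ is constant on double cosets of $H$). $\mathcal{H}(G,H)$ is the space of finitely supported complex functions on the set of double cosets $G//H$, regarded as $H$-bi-invariant functions on $G$; elements of $\ell^2(H\backslash G)$ are regarded as left $H$-invariant functions on $G$. The regular representation $\lambda:\mathcal{H}(G,H)\to\mathcal{B}(\ell^2(H\backslash G))$ is $\lambda(f)(\xi)(g)=\sum_{h\in H\backslash G} f(gh^{-1})\xi(h)$ (sum over representatives of right cosets). For $s\geq 0$, $\|f\|_{s,L}=\big(\sum_{g\in H\backslash G}|f(g)|^2(1+L(g))^{2s}\big)^{1/2}$. The Hecke pair $(G,H)$ has property (RD) with respect to a length function $L$ on $(G,H)$ if there are $C,s>0$ with $\|\lambda(f)\|\leq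 C\|f\|_{s,L}$ for all $f\in\mathcal{H}(G,H)$. The Hecke pair $(G,H)$ has (RD) if ($H$ is almost normal in $G$ and) it has (RD) with respect to some length function on $(G,H)$. A group $Q$ has (RD) if the Hecke pair $(Q,\{1\})$ has (RD). *)

(* Defs.v *)
From HB Require Import structures.
From mathcomp Require Import all_boot all_order all_algebra.
From mathcomp Require Import all_classical all_reals all_analysis.
From mathcomp Require Import generic_quotient complex.
Set Implicit Arguments.
Unset Strict Implicit.
Unset Printing Implicit Defensive.
Import Order.TTheory GRing.Theory Num.Theory.

Local Open Scope classical_set_scope.
Local Open Scope quotient_scope.
Local Open Scope group_scope.

(* A subgroup of G is a [groupClosed G]: a predicate on G containing 1 and
   closed under products and inverses. With the classical axioms of boolp,
   every subset of G is given by a boolean predicate. *)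

Section Subgroups.
Variable G : groupType.
Implicit Types (A B : set G) (H K : groupClosed G).

Definition lcoset (x : G) A : set G := [set x * a | a in A].

Definition dcoset A (x : G) : set G :=
  [set z | exists a b, [/\ A a, A b & z = a * x * b]].

Definition conj_set (x : G) A : set G := [set x * a * x^-1 | a in A].

Definition finite_index A B : Prop := finite_set [set lcoset b A | b in B].

Definition commensurable H K : Prop :=
  exists g : G,
    let I := [set` H] `&` conj_set g [set` K] in
    finite_index I [set` H] /\ finite_index I (conj_set g [set` K]).

Definition almost_normal H : Prop :=
  forall g : G, exists F : set G,
    finite_set F /\ dcoset [set` H] g = \bigcup_(x in F) lcoset x [set` H].

Definition normal_subgroup H : Prop :=
  forall g h : G, h \in H -> g * h * g^-1 \in H.

Definition trivial_subgroup : {pred G} := pred1 1.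

Lemma trivial_subgroupM : mulg_closed trivial_subgroup.
Proof. by move=> x y /eqP-> /eqP->; rewrite inE mulg1. Qed.

Lemma trivial_subgroup1 : 1 \in trivial_subgroup.
Proof. by rewrite inE. Qed.

Lemma trivial_subgroupV : invg_closed trivial_subgroup.
Proof. by move=> x /eqP->; rewrite inE invg1. Qed.

HB.instance Definition _ := isMulClosed.Build G trivial_subgroup trivial_subgroupM.
HB.instance Definition _ := isMul1Closed.Build G trivial_subgroup trivial_subgroup1.
HB.instance Definition _ := isInvClosed.Build G trivial_subgroup trivial_subgroupV.

End Subgroups.

Section RightCosets.
Variables (G : groupType) (H : groupClosed G).

(* x ~ y iff H x = H y *)
Definition rcoset_rel : rel G := fun x y => x * y^-1 \in H.

Lemma rcoset_rel_refl : reflexive rcoset_rel.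
Proof. by move=> x; rewrite /rcoset_rel mulgV gpred1. Qed.

Lemma rcoset_rel_sym : symmetric rcoset_rel.
Proof. by move=> x y; rewrite /rcoset_rel gpredFC. Qed.

Lemma rcoset_rel_trans : transitive rcoset_rel.
Proof.
move=> y x z xy yz; rewrite /rcoset_rel.
by rewrite -[x](mulgVK y) -mulgA gpredM.
Qed.

Canonical rcoset_equiv :=
  EquivRel rcoset_rel rcoset_rel_refl rcoset_rel_sym rcoset_rel_trans.

(* The set H \ G; [repr c] is a chosen representative of the coset c. *)
Definition rcosets : Type := {eq_quot rcoset_equiv}.
HB.instance Definition _ := Choice.on rcosets.
HB.instance Definition _ := EqQuotient.on rcosets.

End RightCosets.

Section QuotientGroup.
Variables (G : groupType) (H : groupClosed G) (nH : normal_subgroup H).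

(* For normal H left and right cosets agree, so G / H has carrier H \ G. *)
Definition quotient_group of normal_subgroup H : Type := rcosets H.
Local Notation Q := (quotient_group nH).

HB.instance Definition _ := Choice.on Q.
HB.instance Definition _ := EqQuotient.on Q.

Definition quotient_one : Q := \pi_Q 1.
Definition quotient_mul (c d : Q) : Q := \pi_Q (repr c * repr d).
Definition quotient_inv (c : Q) : Q := \pi_Q (repr c)^-1.

Lemma quotient_eqP (x y : G) : reflect (\pi_Q x = \pi_Q y) (x * y^-1 \in H).
Proof. exact: (iffP (@eqquotP _ _ (rcosets H) x y)). Qed.

Lemma quotient_reprP (x : G) : exists2 h, h \in H & repr (\pi_Q x) = h * x.
Proof.
exists (repr (\pi_Q x) * x^-1); last by rewrite mulgVK.
by apply/quotient_eqP; rewrite reprK.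
Qed.

Lemma quotient_mulE (x y : G) :
  quotient_mul (\pi_Q x) (\pi_Q y) = \pi_Q (x * y).
Proof.
rewrite /quotient_mul.
have [h hH ->] := quotient_reprP x; have [k kH ->] := quotient_reprP y.
apply/quotient_eqP; rewrite invgM !mulgA mulgK -!mulgA gpredM//.
by have := nH x kH; rewrite !mulgA.
Qed.

Lemma quotient_invE (x : G) : quotient_inv (\pi_Q x) = \pi_Q x^-1.
Proof.
rewrite /quotient_inv; have [h hH ->] := quotient_reprP x; apply/quotient_eqP.
by rewrite invgM; apply: nH; rewrite gpredV.
Qed.

Lemma quotient_mulA : associative quotient_mul.
Proof.
move=> a b c; rewrite -[a]reprK -[b]reprK -[c]reprK.
move: (repr a) (repr b) (repr c) => x y z.
by rewrite (quotient_mulE y z) (quotient_mulE x y) !quotient_mulE mulgA.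
Qed.

Lemma quotient_mul1 : left_id quotient_one quotient_mul.
Proof. by move=> a; rewrite -[a]reprK /quotient_one quotient_mulE mul1g. Qed.

Lemma quotient_mulr1 : right_id quotient_one quotient_mul.
Proof. by move=> a; rewrite -[a]reprK /quotient_one quotient_mulE mulg1. Qed.

Lemma quotient_mulV : left_inverse quotient_one quotient_inv quotient_mul.
Proof.
by move=> a; rewrite -[a]reprK quotient_invE quotient_mulE mulVg.
Qed.

Lemma quotient_mulrV : right_inverse quotient_one quotient_inv quotient_mul.
Proof.
by move=> a; rewrite -[a]reprK quotient_invE quotient_mulE mulgV.
Qed.

HB.instance Definition _ := isGroup.Build Q quotient_mulA quotient_mul1
  quotient_mulr1 quotient_mulV quotient_mulrV.

End QuotientGroup.

Local Close Scope group_scope.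
Local Open Scope ring_scope.

Section LengthFunctions.
Variables (R : realType) (G : groupType).

Record length_function (L : G -> R) : Prop := LengthFunction {
  length_ge0 : forall g, 0 <= L g;
  length1 : L 1%g = 0;
  lengthV : forall g, L (g^-1)%g = L g;
  lengthM : forall g h, L (g * h)%g <= L g + L h
}.

Definition length_kernel (L : G -> R) : set G := [set g | L g = 0].

Definition length_on_pair (H : groupClosed G) (L : G -> R) : Prop :=
  length_function L /\ [set` H] `<=` length_kernel L.

End LengthFunctions.

Section RapidDecay.
Variables (R : realType) (G : groupType) (H : groupClosed G).
Local Notation C := R[i].
Local Notation normc := ComplexField.Normc.normc.

Definition left_invariant (xi : G -> C) : Prop :=
  forall h g, h \in H -> xi (h * g)%g = xi g.

Definition bi_invariant (f : G -> C) : Prop :=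
  forall h g k, h \in H -> k \in H -> f (h * g * k)%g = f g.

Definition hecke_algebra : set (G -> C) :=
  [set f | bi_invariant f /\
           finite_set [set dcoset [set` H] g | g in [set g | f g != 0]]].

(* The l^2(H \ G) norm of a left H-invariant function; +oo if the sum of
   squares diverges. *)
Definition l2norm (xi : G -> C) : \bar R :=
  sqrte (\esum_(c in [set: rcosets H]) (normc (xi (repr c)) ^+ 2)%:E)%E.

Definition l2 : set (G -> C) :=
  [set xi | left_invariant xi /\ (l2norm xi < +oo)%E].

(* For almost normal H, f in hecke_algebra and xi left H-invariant, the
   summand only depends on c and is nonzero for finitely many c only. *)
Definition regular_rep (f xi : G -> C) : G -> C := fun g =>
  \sum_(c \in [set: rcosets H]) f (g * (repr c)^-1)%g * xi (repr c).

(* The operator norm on l^2(H \ G); +oo if T is unbounded, or maps some vector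
   of the unit ball out of l^2. *)
Definition operator_norm (T : (G -> C) -> (G -> C)) : \bar R :=
  ereal_sup [set l2norm (T xi) | xi in [set xi | l2 xi /\ (l2norm xi <= 1)%E]].

(* For almost normal H and f in hecke_algebra, this is a finite sum. *)
Definition weighted_norm (s : R) (L : G -> R) (f : G -> C) : R :=
  Num.sqrt (\sum_(c \in [set: rcosets H])
              normc (f (repr c)) ^+ 2 * (1 + L (repr c)) `^ (2 * s)).

Definition has_RD_wrt (L : G -> R) : Prop :=
  exists K s : R, [/\ 0 < K, 0 < s &
    forall f, hecke_algebra f ->
      (operator_norm (regular_rep f) <= (K * weighted_norm s L f)%:E)%E].

Definition pair_has_RD : Prop :=
  almost_normal H /\ exists L : G -> R, length_on_pair H L /\ has_RD_wrt L.

End RapidDecay.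

Definition group_has_RD (R : realType) (Q : groupType) : Prop :=
  pair_has_RD R (@trivial_subgroup Q : groupClosed Q).

(* Main.v *)
(* Rapid decay only has to be tested on nonnegative real functions, where all
   sums are sums in [0, +oo] and can be compared through injections between
   index sets. Let I be a subgroup of finite index n in K. For K-left-invariant
   functions the sums over K\G and I\G agree up to a factor n; replacing an
   I-invariant function by its maximum over the cosets K g or K g K enlarges its
   weighted l^2 norm only by a constant factor, and replacing a length function
   by its maximum over K g K (and by 0 on K) changes it by a bounded amount. So
   (G, I) has (RD) iff (G, K) does. As H is normal, commensurability gives that
   H meets K in a subgroup of finite index in both, and for normal H the sums
   over H\G are sums over the group G/H. *)
Require Import Defs.
From mathcomp Require Import all_boot all_order all_algebra.
From mathcomp Require Import all_classical all_reals all_analysis.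
From mathcomp Require Import generic_quotient complex.
From HB Require Import structures.
Set Implicit Arguments.
Unset Strict Implicit.
Unset Printing Implicit Defensive.
Import Order.TTheory GRing.Theory Num.Theory.

Local Open Scope classical_set_scope.
Local Open Scope ring_scope.

(** * Comparison of sums in [0, +oo] *)

Section ExtendedSums.
Variable R : realType.
Local Open Scope ereal_scope.

Lemma le_esum_inj (T U : choiceType) (a : T -> \bar R) (b : U -> \bar R)
    (tau : T -> U) :
  injective tau -> (forall u, 0 <= b u) -> (forall t, a t <= b (tau t)) ->
  \esum_(t in [set: T]) a t <= \esum_(u in [set: U]) b u.
Proof.
move=> tauI b0 ab; apply: (@le_trans _ _ (\esum_(t in [set: T]) b (tau t))).
  by apply: le_esum => t _; exact: ab.
rewrite -(@esum_image R _ _ setT tau b); last by move=> x y _ _; exact: tauI.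
rewrite esum_mkcond; apply: le_esum => u _; case: ifP => // _; exact: b0.
Qed.

(** A map that is at most n-to-one becomes injective once a label in ['I_n] is recorded; the labels
    cost the factor n. *)
Lemma esum_ord_pair n (T : choiceType) (b : T -> \bar R) :
  (forall t, 0 <= b t) ->
  \esum_(p in [set: 'I_n * T]) b p.2 = n%:R%:E * \esum_(t in [set: T]) b t.
Proof.
move=> b0.
have -> : [set: 'I_n * T] = [set: 'I_n] `*`` (fun=> [set: T]).
  by apply/seteqP; split.
rewrite -(@esum_esum R _ _ _ _ (fun _ t => b t))//.
have s0 : 0 <= \esum_(t in [set: T]) b t by apply: esum_ge0.
have -> : [set: 'I_n] = [set` enum 'I_n].
  by apply/seteqP; split => // i _; rewrite /= mem_enum.
rewrite esum_fset// -fsbig_seq ?enum_uniq// big_enum/=.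
by rewrite sumr_const card_ord mule_natl.
Qed.

Lemma esumZ_le (T : choiceType) (c : R) (a : T -> \bar R) :
  (0 <= c)%R -> (forall t, 0 <= a t) ->
  \esum_(t in [set: T]) (c%:E * a t) <= c%:E * \esum_(t in [set: T]) a t.
Proof.
move=> c0 a0; apply: ge_ereal_sup => _ [X XT <-].
rewrite -ge0_mule_fsumr//; apply: lee_wpmul2l; first by rewrite lee_fin.
by apply: esum_ge; exists X.
Qed.

End ExtendedSums.

(** * Invariant functions, almost normality and finite index *)

Section Cosets.
Variable G : groupType.
Implicit Types (H K I : groupClosed G).
Local Open Scope group_scope.

Definition left_inv (T : Type) H (f : G -> T) : Prop :=
  forall h g, h \in H -> f (h * g) = f g.

Definition double_inv (T : Type) H (f : G -> T) : Prop :=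
  forall h g k, h \in H -> k \in H -> f (h * g * k) = f g.

Lemma double_inv_left (T : Type) H (f : G -> T) : double_inv H f -> left_inv H f.
Proof. by move=> fH h g hH; rewrite -(fH h g 1)// ?mulg1// gpred1. Qed.

Lemma double_inv_right (T : Type) H (f : G -> T) g h :
  double_inv H f -> h \in H -> f (g * h) = f g.
Proof. by move=> fH hH; rewrite -(fH 1 g h)// ?mul1g// gpred1. Qed.

Lemma pi_rcosetP H (x y : G) :
  reflect (\pi_(rcosets H)%qT x = \pi_(rcosets H)%qT y) (x * y^-1 \in H).
Proof. exact: (iffP (@eqquotP _ _ (rcosets H) x y)). Qed.

Lemma repr_rcosetP H (x : G) :
  exists2 h, h \in H & repr (\pi_(rcosets H)%qT x) = h * x.
Proof.
exists (repr (\pi_(rcosets H)%qT x) * x^-1); last by rewrite mulgVK.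
by apply/pi_rcosetP; rewrite reprK.
Qed.

Lemma left_inv_repr (T : Type) H (f : G -> T) x :
  left_inv H f -> f (repr (\pi_(rcosets H)%qT x)) = f x.
Proof. by move=> fH; have [h hH ->] := repr_rcosetP H x; exact: fH. Qed.

Lemma eq_rcosets H (c d : rcosets H) : repr c * (repr d)^-1 \in H -> c = d.
Proof. by move=> /pi_rcosetP; rewrite !reprK. Qed.

Lemma eq_dcoset H x z : dcoset [set` H] x z -> dcoset [set` H] z = dcoset [set` H] x.
Proof.
move=> [a [b [/= aH bH ->]]]; apply/seteqP; split => y [c [d [/= cH dH ->]]].
  by exists (c * a), (b * d); split; rewrite /= ?gpredM// !mulgA.
exists (c * a^-1), (b^-1 * d); split; rewrite /= ?gpredM ?gpredV//.
by rewrite !mulgA mulgVK mulgK.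
Qed.

Lemma dcoset_refl H x : dcoset [set` H] x x.
Proof. by exists 1, 1; rewrite /= gpred1 mul1g mulg1. Qed.

(** It suffices to cover the coset H g, since right multiplication by H preserves each left coset x
    H. *)
Lemma almost_normalP H : almost_normal H <->
  forall g, exists2 F : set G, finite_set F &
    forall k, k \in H -> exists2 x, F x & x^-1 * (k * g) \in H.
Proof.
split=> HG g.
  have [F [finF dF]] := HG g; exists F => // k kH.
  have : dcoset [set` H] g (k * g).
    by exists k, 1; rewrite /= gpred1 mulg1.
  by rewrite dF => -[x Fx [h hH <-]]; exists x => //; rewrite mulKg.
have [F finF FP] := HG g.
(* The cover may contain x outside H g H; discarding those turns the inclusion into an equality. *)
exists [set x | F x /\ dcoset [set` H] g x]; split.
  by apply: sub_finite_set finF => x [].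
apply/seteqP; split => [z [a [b [/= aH bH ->]]]|z [x [Fx gx] [h hH <-]]].
  have [x Fx xH] := FP a aH; exists x.
    split=> //; exists a, (x^-1 * (a * g))^-1; rewrite /= gpredV; split=> //.
    by rewrite invgM invgK mulgA mulgV mul1g.
  exists (x^-1 * (a * g) * b); first by rewrite /= gpredM.
  by rewrite !mulgA mulgV mul1g.
move: gx => [a [b [/= aH bH ->]]]; exists a, (b * h); split=> //=.
  by rewrite gpredM.
by rewrite !mulgA.
Qed.

(* The index of I in K is at most n + 1: [t] meets every left coset of I in K,
   possibly several times. *)
Definition index_le I K n : Prop := exists t : 'I_n.+1 -> G,
  (forall i, t i \in K) /\ forall k, k \in K -> exists i, (t i)^-1 * k \in I.

(** Inversion turns the cover of K by the cosets [t i] I into a cover by the cosets I [(t i)^-1]. *)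
Lemma index_le_left I K n (t : 'I_n.+1 -> G) :
  (forall k, k \in K -> exists i, (t i)^-1 * k \in I) ->
  forall k, k \in K -> exists i, k * t i \in I.
Proof.
move=> tP k kK; have [|i ti] := tP k^-1; first by rewrite gpredV.
by exists i; rewrite -gpredV invgM.
Qed.

Section FiniteIndex.
Variables (I K : groupClosed G) (n : nat).
Hypotheses (sIK : {subset I <= K}) (idxIK : index_le I K n).

Lemma double_inv_sub (T : Type) (f : G -> T) : double_inv K f -> double_inv I f.
Proof. by move=> fK h g k hI kI; apply: fK; exact: sIK. Qed.

Lemma left_inv_sub (T : Type) (f : G -> T) : left_inv K f -> left_inv I f.
Proof. by move=> fK h g hI; apply: fK; exact: sIK. Qed.

(** Each x K is the union of the cosets x [t i] I, so a finite cover of K g yields one of I g by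
    left cosets of I. *)
Lemma almost_normal_sub : almost_normal K -> almost_normal I.
Proof.
move=> /almost_normalP KG; apply/almost_normalP => g.
have [F finF FP] := KG g; have [t [tK tP]] := idxIK.
exists [set x * t i | x in F & i in [set: 'I_n.+1]].
  exact: finite_image2.
move=> k kI; have [x Fx xK] := FP k (sIK kI).
have [i ti] := tP _ xK; exists (x * t i); first by exists x => //; exists i.
by rewrite invgM -mulgA.
Qed.

(** If finitely many cosets x I cover I g, then the cosets [t i] x K cover K g. *)
Lemma almost_normal_sup : almost_normal I -> almost_normal K.
Proof.
move=> /almost_normalP IG; apply/almost_normalP => g.
have [F finF FP] := IG g; have [t [tK tP]] := idxIK.
exists [set t i * x | i in [set: 'I_n.+1] & x in F].
  exact: finite_image2.
move=> k kK; have [i ti] := tP _ kK; have [x Fx xI] := FP _ ti.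
exists (t i * x); first by exists i => //; exists x.
by rewrite invgM; apply: sIK; rewrite !mulgA in xI *.
Qed.

End FiniteIndex.
End Cosets.

(** * Sums over H\G and rapid decay for nonnegative functions *)

Section CosetSums.
Variables (R : realType) (G : groupType).
Implicit Types (H : groupClosed G) (f xi L : G -> R).
Local Open Scope ereal_scope.

Definition coset_sum H (phi : G -> \bar R) : \bar R :=
  \esum_(c in [set: rcosets H]) phi (repr c).

Lemma coset_sum_ge0 H phi : (forall g, 0 <= phi g) -> 0 <= coset_sum H phi.
Proof. by move=> phi0; apply: esum_ge0. Qed.

Lemma le_coset_sum H phi psi :
  (forall g, phi g <= psi g) -> coset_sum H phi <= coset_sum H psi.
Proof. by move=> le; apply: le_esum. Qed.

Lemma eq_coset_sum H phi psi :
  (forall g, phi g = psi g) -> coset_sum H phi = coset_sum H psi.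
Proof. by move=> e; apply: eq_esum. Qed.

Lemma coset_sumZ_le H (c : R) phi : (0 <= c)%R -> (forall g, 0 <= phi g) ->
  coset_sum H (fun g => c%:E * phi g) <= c%:E * coset_sum H phi.
Proof. by move=> c0 phi0; apply: esumZ_le. Qed.

Lemma double_inv_mulV H f g : double_inv H f -> left_inv H (fun h => f (g * h^-1)%g).
Proof.
by move=> fH h x hH /=; rewrite invgM mulgA (double_inv_right _ fH)// gpredV.
Qed.

(** The value of lambda(f)(xi) at g for nonnegative [f] and [xi], with +oo allowed. *)
Definition convolution H f xi (g : G) : \bar R :=
  coset_sum H (fun h => (f (g * h^-1)%g * xi h)%:E).

Lemma convolution_ge0 H f xi g : (forall x, (0 <= f x)%R) ->
  (forall x, (0 <= xi x)%R) -> 0 <= convolution H f xi g.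
Proof. by move=> f0 xi0; apply: coset_sum_ge0 => h; rewrite lee_fin mulr_ge0. Qed.

Lemma convolution_left_inv H f xi : double_inv H f -> left_inv H (convolution H f xi).
Proof.
move=> fH h g hH; apply: eq_coset_sum => x.
by rewrite -mulgA (double_inv_left fH _ hH).
Qed.

Lemma convolution_summand_left_inv H f xi g : double_inv H f -> left_inv H xi ->
  left_inv H (fun h => (f (g * h^-1)%g * xi h)%:E).
Proof. by move=> fH xiH h x hH; rewrite (double_inv_mulV g fH)// xiH. Qed.

Definition coset_finite H f : Prop := exists2 X : set G, finite_set X &
  forall x, f x != 0%R -> exists2 y, X y & dcoset [set` H] y x.

Definition l2_energy H f xi : \bar R :=
  coset_sum H (fun g => convolution H f xi g * convolution H f xi g).

Definition weighted_energy H (s : R) L f : \bar R :=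
  coset_sum H (fun g => (f g ^+ 2 * (1 + L g) `^ (2 * s))%:E).

Lemma weighted_energy_ge0 H s L f : 0 <= weighted_energy H s L f.
Proof. by apply: coset_sum_ge0 => g; rewrite lee_fin mulr_ge0// ?sqr_ge0 ?powR_ge0. Qed.

(** The (RD) inequality on nonnegative functions with both sides squared: [C] stands for the square
    of the constant in (RD). *)
Definition positive_RD H L (C s : R) : Prop :=
  forall f, double_inv H f -> (forall g, (0 <= f g)%R) -> coset_finite H f ->
  forall xi, left_inv H xi -> (forall g, (0 <= xi g)%R) ->
    coset_sum H (fun g => (xi g ^+ 2)%:E) <= 1 ->
    l2_energy H f xi <= C%:E * weighted_energy H s L f.

(** Multiplying by elements of length 0 cannot increase L; undoing the multiplication gives the
    reverse inequality. *)
Lemma length_double_inv H L : length_on_pair H L -> double_inv H L.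
Proof.
move=> [lL LH] h g k hH kH.
have L0 x : x \in H -> L x = 0%R by move=> xH; exact: LH.
have le h' g' k' : h' \in H -> k' \in H -> (L (h' * g' * k')%g <= L g')%R.
  move=> hH' kH'; apply: le_trans (lengthM lL _ _) _.
  rewrite (L0 k')// addr0; apply: le_trans (lengthM lL _ _) _.
  by rewrite L0// add0r.
apply/eqP; rewrite eq_le le//=.
have := le h^-1%g (h * g * k)%g k^-1%g.
by rewrite !mulgA mulVg mul1g mulgK; apply; rewrite gpredV.
Qed.

Section FiniteIndexSums.
Variables (I K : groupClosed G) (n : nat).
Hypotheses (sIK : {subset I <= K}) (idxIK : index_le I K n).

(** Send K g to the coset I k g of the point where [phi] dominates [psi g]. As I lies in K, this
    coset determines K g, so the map is injective. *)
Lemma coset_sum_le_sub (phi psi : G -> \bar R) : left_inv I phi ->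
  (forall g, 0 <= phi g) ->
  (forall g, exists2 k, k \in K & psi g <= phi (k * g)%g) ->
  coset_sum K psi <= coset_sum I phi.
Proof.
move=> phiI phi0 psiphi.
have [k kP] : {k : G -> G & forall g, k g \in K /\ psi g <= phi (k g * g)%g}.
  apply: (@choice _ _ (fun g k => k \in K /\ psi g <= phi (k * g)%g)) => g.
  by have [k] := psiphi g; exists k.
rewrite /coset_sum; apply: (@le_esum_inj _ _ _ _ _
  (fun d : rcosets K => \pi_(rcosets I)%qT (k (repr d) * repr d)%g)) => //.
  move=> c d /pi_rcosetP /sIK; rewrite invgM !mulgA gpredFr; last first.
    by have [] := kP (repr d).
  by rewrite -!mulgA gpredMl; [exact: eq_rcosets | have [] := kP (repr c)].
by move=> d; rewrite (left_inv_repr _ phiI); have [] := kP (repr d).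
Qed.

(** With a factor [t i] on the right, different cosets K g may be sent to the same coset of I.
    Recording i restores injectivity. *)
Lemma coset_sum_le_sub_mulr (phi psi : G -> \bar R) (t : 'I_n.+1 -> G) :
  left_inv I phi -> (forall g, 0 <= phi g) ->
  (forall g, exists i, exists2 k, k \in K & psi g <= phi (k * g * t i)%g) ->
  coset_sum K psi <= n.+1%:R%:E * coset_sum I phi.
Proof.
move=> phiI phi0 psiphi; rewrite /coset_sum -esum_ord_pair//.
have [p pP] : {p : G -> 'I_n.+1 * G & forall g, (p g).2 \in K /\
    psi g <= phi ((p g).2 * g * t (p g).1)%g}.
  apply: (@choice _ _ (fun g q => q.2 \in K /\ psi g <= phi (q.2 * g * t q.1)%g)).
  by move=> g; have [i [k kK]] := psiphi g; exists (i, k).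
apply: (@le_esum_inj _ _ _ _ _ (fun d : rcosets K => ((p (repr d)).1,
  \pi_(rcosets I)%qT ((p (repr d)).2 * repr d * t (p (repr d)).1)%g))) => //=.
  move=> c d [-> /pi_rcosetP /sIK]; rewrite !invgM !mulgA mulgK.
  rewrite gpredFr; last by have [] := pP (repr d).
  by rewrite -!mulgA gpredMl; [exact: eq_rcosets | have [] := pP (repr c)].
by move=> d; rewrite (left_inv_repr _ phiI); have [] := pP (repr d).
Qed.

(** The coset I x is recovered from K x and a label i: it equals I [(t i)^-1] r, where r is the
    chosen representative of K x. *)
Lemma coset_sum_le_sup (phi : G -> \bar R) : left_inv K phi ->
  (forall g, 0 <= phi g) -> coset_sum I phi <= n.+1%:R%:E * coset_sum K phi.
Proof.
move=> phiK phi0; rewrite /coset_sum -esum_ord_pair//.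
have [t [tK tP]] := idxIK; have tP' := index_le_left tP.
have rK g : (g * (repr (\pi_(rcosets K)%qT g))^-1)%g \in K.
  by apply/pi_rcosetP; rewrite reprK.
have [i iP] := choice (fun g => tP' _ (rK g)).
apply: (@le_esum_inj _ _ _ _ _ (fun c : rcosets I =>
  (i (repr c), \pi_(rcosets K)%qT (repr c)))) => //=.
  move=> c d [icd picd]; apply: eq_rcosets.
  have := iP (repr d); rewrite -gpredV -(gpredMl _^-1 (iP (repr c))).
  by rewrite icd picd !invgM !mulgA mulgK invgK mulgVK.
by move=> c; rewrite (left_inv_repr _ phiK).
Qed.

End FiniteIndexSums.
End CosetSums.

(** * Maxima over cosets and double cosets *)

Section Maxima.
Variables (R : realType) (G : groupType).
Implicit Types (f xi : G -> R).

Lemma sup_max (A : set R) x : A x -> ubound A x -> sup A = x.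
Proof.
move=> Ax xA; apply/eqP; rewrite eq_le ge_sup//=; last by exists x.
by apply: ub_le_sup => //; exists x.
Qed.

Definition left_max (K : groupClosed G) xi (g : G) : R :=
  sup [set xi (k * g)%g | k in [set` K]].

Definition double_max (K : groupClosed G) f (g : G) : R :=
  sup [set f z | z in dcoset [set` K] g].

Lemma left_max_inv K xi : left_inv K (left_max K xi).
Proof.
move=> h g hK; congr sup; apply/seteqP; split=> [_ [k /= kK <-]|_ [k /= kK <-]].
  by exists (k * h)%g; rewrite /= ?gpredM// mulgA.
by exists (k * h^-1)%g; rewrite /= ?gpredM ?gpredV// mulgA mulgVK.
Qed.

Lemma double_max_inv K f : double_inv K (double_max K f).
Proof.
move=> h g k hK kK; rewrite /double_max (@eq_dcoset _ _ g)//.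
by exists h, k.
Qed.

Section FiniteIndexMaxima.
Variables (I K : groupClosed G) (n : nat) (t : 'I_n.+1 -> G).
Hypotheses (tK : forall i, t i \in K).
Hypotheses (tP : forall k, k \in K -> exists i, ((t i)^-1 * k)%g \in I).

(** By left invariance under I, [xi] takes on K g only its values at the points [(t i)^-1 * g], so a
    largest one exists. *)
Lemma left_maxP xi g : left_inv I xi ->
  (exists2 k, k \in K & left_max K xi g = xi (k * g)%g) /\
  (forall k, k \in K -> xi (k * g)%g <= left_max K xi g).
Proof.
move=> xiI; pose F i := xi ((t i)^-1 * g)%g.
have [i _ iP] := @Order.TotalTheory.arg_maxP _ _ _ ord0 xpredT F isT.
have tiK : (t i)^-1%g \in K by rewrite gpredV.
have ub k : k \in K -> xi (k * g)%g <= F i.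
  move=> kK; have [j jI] := index_le_left tP kK.
  rewrite (_ : (k * g = (k * t j) * ((t j)^-1 * g))%g); last first.
    by rewrite !mulgA mulgK.
  by rewrite xiI//; exact: iP.
have -> : left_max K xi g = F i.
  by apply: sup_max; [exists (t i)^-1%g | move=> _ [k /= kK <-]; exact: ub].
by split => //; exists (t i)^-1%g.
Qed.

(** On K g K only the values at [(t i)^-1 * g * t j] occur. The right factor of the maximizer is one
    of the [t i], the shape that [coset_sum_le_sub_mulr] expects. *)
Lemma double_maxP f g : double_inv I f ->
  (exists i, exists2 k, k \in K & double_max K f g = f (k * g * t i)%g) /\
  (forall z, dcoset [set` K] g z -> f z <= double_max K f g).
Proof.
move=> fI; pose F (p : 'I_n.+1 * 'I_n.+1) := f ((t p.1)^-1 * g * t p.2)%g.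
have [p _ pP] := @Order.TotalTheory.arg_maxP _ _ _ (ord0, ord0) xpredT F isT.
have tiK : (t p.1)^-1%g \in K by rewrite gpredV.
have ub z : dcoset [set` K] g z -> f z <= F p.
  move=> [a [b [/= aK bK ->]]].
  have [i iI] := index_le_left tP aK; have [j jI] := tP bK.
  rewrite (_ : (a * g * b =
    (a * t i) * ((t i)^-1 * g * t j) * ((t j)^-1 * b))%g); last first.
    by rewrite !mulgA !(mulgK, mulgVK).
  by rewrite fI//; exact: (pP (i, j)).
have -> : double_max K f g = F p.
  apply: sup_max; last by move=> _ [z gz <-]; exact: ub.
  exists ((t p.1)^-1 * g * t p.2)%g => //.
  by exists (t p.1)^-1%g, (t p.2); split=> //=.
by split => //; exists p.2, (t p.1)^-1%g.
Qed.

Hypothesis sIK : {subset I <= K}.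

Lemma coset_finite_sub f : coset_finite K f -> coset_finite I f.
Proof.
move=> [X finX XP].
exists [set (t p.1)^-1 * y * t p.2 | p in [set: 'I_n.+1 * 'I_n.+1] & y in X]%g.
  exact: finite_image2.
move=> x /XP[y Xy [a [b [/= aK bK ->]]]].
have [i iI] := index_le_left tP aK; have [j jI] := tP bK.
exists ((t i)^-1 * y * t j)%g; first by exists (i, j) => //; exists y.
by exists (a * t i)%g, ((t j)^-1 * b)%g; split; rewrite //= !mulgA !(mulgK, mulgVK).
Qed.

(** A nonzero maximum at x is a value of [f] at some k x [t i], which lies in I y I for one of the
    given y; hence x lies in K y K. *)
Lemma coset_finite_double_max f :
  double_inv I f -> coset_finite I f -> coset_finite K (double_max K f).
Proof.
move=> fI [X finX XP]; exists X => // x.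
have [[i [k kK ->]] _] := double_maxP x fI => /XP[y Xy [a [b [/= aI bI e]]]].
exists y => //; exists (k^-1 * a)%g, (b * (t i)^-1)%g.
split; rewrite /= ?gpredM ?gpredV// ?sIK//.
have -> : (x = k^-1 * (k * x * t i) * (t i)^-1)%g.
  by rewrite !mulgA mulgK mulVg mul1g.
by rewrite e !mulgA.
Qed.

End FiniteIndexMaxima.
End Maxima.

(** * Transfer of rapid decay between I and K *)

Section FiniteIndexRD.
Variables (R : realType) (G : groupType) (I K : groupClosed G) (n : nat).
Hypotheses (sIK : {subset I <= K}) (idxIK : index_le I K n).
Implicit Types (f xi L : G -> R).

(* The maximum over K g K is subadditive but need not vanish on K, whence the
   value 0 imposed there. *)
Lemma length_extension L : length_on_pair I L ->
  exists L' M, [/\ 0 <= M, length_on_pair K L' &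
    forall g, 1 + L g <= (1 + M) * (1 + L' g)].
Proof.
move=> lIL; have LI := length_double_inv lIL; have [lL _] := lIL.
have [t [tK tP]] := idxIK.
pose D := double_max K L.
have DK : double_inv K D := @double_max_inv _ _ K L.
have leD g : L g <= D g.
  by have [_] := double_maxP tK tP g LI; apply; exact: dcoset_refl.
have DP g : exists a b, [/\ a \in K, b \in K & D g = L (a * g * b)%g].
  have [[i [k kK e]] _] := double_maxP tK tP g LI.
  by exists k, (t i).
have Dub g a b : a \in K -> b \in K -> L (a * g * b)%g <= D g.
  by move=> aK bK; have [_] := double_maxP tK tP g LI; apply; exists a, b.
have D0 g : 0 <= D g by apply: le_trans (leD g); exact: length_ge0.
have DV g : D g^-1%g <= D g.
  have [a [b [aK bK ->]]] := DP g^-1%g; rewrite -(lengthV lL) !invgM invgK mulgA.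
  by apply: Dub; rewrite gpredV.
have DM g h : D (g * h)%g <= D g + D h.
  have [a [b [aK bK ->]]] := DP (g * h)%g.
  rewrite (_ : (a * (g * h) * b = (a * g * 1) * (1 * h * b))%g); last first.
    by rewrite mulg1 mul1g !mulgA.
  by apply: le_trans (lengthM lL _ _) _; apply: lerD; apply: Dub; rewrite ?gpred1.
pose L' g : R := if g \in K then 0 else D g.
have L'0 g : 0 <= L' g by rewrite /L'; case: ifP.
(* [D 1] is the maximum of L on K and absorbs the loss from setting [L'] to 0 there. *)
exists L', (D 1%g); split => //.
  split; last by move=> g /= gK; rewrite /length_kernel /= /L' gK.
  split => // [|g|g h]; rewrite /L' ?gpred1// ?gpredV.
    by case: ifP => // _; apply/eqP; rewrite eq_le DV -[X in D X <= _]invgK DV.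
  have [gK|gK] := boolP (g \in K).
    by rewrite gpredMl// add0r (double_inv_left DK).
  have [hK|hK] := boolP (h \in K).
    by rewrite gpredMr// (negbTE gK) addr0 (double_inv_right _ DK).
  by case: ifP => // _; rewrite addr_ge0.
move=> g; rewrite mulrDl mul1r -addrA lerD2l /L'.
case: ifPn => gK.
  rewrite addr0 mulr1 add0r.
  by have := Dub 1%g g 1%g; rewrite !mulg1; apply; rewrite ?gpred1.
by rewrite (le_trans (leD g))// lerDl mulr_ge0// addr_ge0.
Qed.

Local Open Scope ereal_scope.

Lemma mule_self_le (x y : \bar R) : 0 <= x -> x <= y -> x * x <= y * y.
Proof. by move=> x0 xy; apply: lee_pmul. Qed.

(** [f] and [xi] are replaced by K-invariant majorants. The fourth power of the index arises as
    follows: two factors from squaring the comparison of convolutions, one from comparing energies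
    over I\G and K\G, one from the weighted norm of the maximum. *)
Lemma positive_RD_sub L (C s : R) : (0 <= C)%R -> length_on_pair K L ->
  positive_RD K L C s -> positive_RD I L (n.+1%:R ^+ 4 * C) s.
Proof.
move=> C0 /length_double_inv LK RD f fI f0 finf xi xiI xi0 xi1.
have [t [tK tP]] := idxIK; pose N : R := n.+1%:R.
have N0 : (0 <= N)%R by rewrite ler0n.
pose F := double_max K f; pose Xi := left_max K xi.
have fP g := double_maxP tK tP g fI; have xiP g := left_maxP tK tP g xiI.
have FK : double_inv K F := @double_max_inv _ _ K f.
have XiK : left_inv K Xi := @left_max_inv _ _ K xi.
have leF g : (f g <= F g)%R by have [_] := fP g; apply; exact: dcoset_refl.
have leXi g : (xi g <= Xi g)%R.
  by have [_ /(_ 1%g)] := xiP g; rewrite mul1g; apply; exact: gpred1.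
have F0 g : (0 <= F g)%R := le_trans (f0 g) (leF g).
have Xi0 g : (0 <= Xi g)%R := le_trans (xi0 g) (leXi g).
(* The norm does not grow: [Xi g] is a value of [xi] on K g, and distinct cosets of K contain
   distinct cosets of I. *)
have Xi1 : coset_sum K (fun g => (Xi g ^+ 2)%:E) <= 1.
  apply: le_trans xi1; apply: (coset_sum_le_sub sIK) => [h g hI|g|g].
  - by rewrite xiI.
  - by rewrite lee_fin sqr_ge0.
  - by have [[k kK e] _] := xiP g; exists k => //; rewrite /Xi e.
have conv_le g : convolution I f xi g <= N%:E * convolution K F Xi g.
  apply: (@le_trans _ _ (convolution I F Xi g)).
    by apply: le_coset_sum => h; rewrite lee_fin ler_pM.
  apply: (coset_sum_le_sup idxIK); last by move=> h; rewrite lee_fin mulr_ge0.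
  exact: convolution_summand_left_inv.
have cK0 g : 0 <= convolution K F Xi g by apply: convolution_ge0.
have cI0 g : 0 <= convolution I f xi g by apply: convolution_ge0.
have e0 g : 0 <= convolution K F Xi g * convolution K F Xi g by rewrite mule_ge0.
apply: (@le_trans _ _ ((N ^+ 2)%:E * (N%:E * l2_energy K F Xi))).
  apply: (@le_trans _ _ (coset_sum I (fun g => (N ^+ 2)%:E *
      (convolution K F Xi g * convolution K F Xi g)))).
    apply: le_coset_sum => g; apply: le_trans (mule_self_le _ (conv_le g)) _ => //.
    by rewrite muleACA -EFinM -expr2.
  apply: le_trans (coset_sumZ_le _ _ _) _; rewrite ?sqr_ge0//.
  apply: lee_wpmul2l; first by rewrite lee_fin sqr_ge0.
  apply: (coset_sum_le_sup idxIK) => // h g hK.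
  by rewrite !(convolution_left_inv Xi FK _ hK).
have finF : coset_finite K F by exact: coset_finite_double_max finf.
have := RD F FK F0 finF Xi XiK Xi0 Xi1; rewrite muleA -EFinM -exprSr => RDF.
apply: (@le_trans _ _ ((N ^+ 3)%:E * (C%:E * (N%:E * weighted_energy I s L f)))).
  apply: lee_wpmul2l; first by rewrite lee_fin exprn_ge0.
  apply: (le_trans RDF); apply: lee_wpmul2l; first by rewrite lee_fin.
  (* [F g] is a value of [f] at some [k * g * t i], where L, being K-bi-invariant, gives the same
     weight as at g. *)
  apply: (coset_sum_le_sub_mulr sIK (t := t)) => // [h g hI|g|g].
  - by rewrite (double_inv_left fI)// (double_inv_left LK)// sIK.
  - by rewrite lee_fin mulr_ge0// ?sqr_ge0 ?powR_ge0.
  - have [[i [k kK e]] _] := fP g; exists i, k => //.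
    by rewrite /F e LK.
rewrite !muleA -!EFinM; apply: lee_wpmul2r; first exact: weighted_energy_ge0.
by rewrite lee_fin mulrAC -exprSr.
Qed.

Lemma positive_RD_sup L (C s : R) : (0 < C)%R -> (0 < s)%R -> length_on_pair I L ->
  positive_RD I L C s ->
  exists L' C', [/\ (0 < C')%R, length_on_pair K L' & positive_RD K L' C' s].
Proof.
move=> C0 s0 lIL RD; have [L' [M [M0 lKL' LL']]] := length_extension lIL.
have LK := length_double_inv lKL'.
have [t [tK tP]] := idxIK; pose N : R := n.+1%:R.
have N0 : (0 < N)%R by rewrite ltr0n.
have N1 : (1 <= N)%R by rewrite ler1n.
(* [N ^+ 2] will come from squaring [f1], the power of [1 + M] from comparing L with [L']; the
   further N in the final constant comes from passing from I\G to K\G. *)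
pose c : R := (N ^+ 2 * (1 + M) `^ (2 * s))%R.
have c0 : (0 < c)%R by rewrite mulr_gt0 ?exprn_gt0 ?powR_gt0 ?ltr_pwDl ?mulr_gt0.
exists L', (C * (c * N))%R; split=> //; first by rewrite mulr_gt0 ?(mulr_gt0 c0).
move=> f fK f0 finf xi xiK xi0 xi1.
(* Dividing [xi] by N makes its norm over I\G at most 1, since N times N^-2 is at most 1. The factor
   N in [f1] compensates, so that the products in the convolution are unchanged. *)
pose f1 g := (N * f g)%R; pose xi2 g := (N^-1 * xi g)%R.
have fI : double_inv I f := double_inv_sub sIK fK.
have f1I : double_inv I f1 by move=> h g k hI kI; rewrite /f1 fI.
have xiI : left_inv I xi := left_inv_sub sIK xiK.
have xi2K : left_inv K xi2 by move=> h g hI; rewrite /xi2 xiK.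
have xi2I : left_inv I xi2 := left_inv_sub sIK xi2K.
have f10 g : (0 <= f1 g)%R by rewrite mulr_ge0// ltW.
have xi20 g : (0 <= xi2 g)%R by rewrite mulr_ge0// invr_ge0 ltW.
have finf1 : coset_finite I f1.
  have [X finX XP] := coset_finite_sub tP finf.
  by exists X => // x; rewrite mulf_eq0 negb_or => /andP[_ /XP].
have xi21 : coset_sum I (fun g => (xi2 g ^+ 2)%:E) <= 1.
  apply: le_trans (coset_sum_le_sup idxIK _ _) _.
  - by move=> h g hK; rewrite xi2K.
  - by move=> g; rewrite lee_fin sqr_ge0.
  have -> : coset_sum K (fun g => (xi2 g ^+ 2)%:E) =
      coset_sum K (fun g => (N^-1 ^+ 2)%:E * (xi g ^+ 2)%:E).
    by apply: eq_coset_sum => g; rewrite -EFinM -exprMn.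
  apply: (@le_trans _ _ (N%:E * ((N^-1 ^+ 2)%:E * 1))).
    apply: lee_wpmul2l; first by rewrite lee_fin ltW.
    apply: le_trans (coset_sumZ_le _ _ _) _; rewrite ?sqr_ge0//.
      by move=> g; rewrite lee_fin sqr_ge0.
    by apply: lee_wpmul2l => //; rewrite lee_fin sqr_ge0.
  rewrite mule1 -EFinM lee_fin expr2 mulrA divff ?gt_eqF// mul1r.
  by rewrite invf_le1.
have cI0 g : 0 <= convolution I f1 xi2 g by apply: convolution_ge0.
have conv_le g : convolution K f xi g <= convolution I f1 xi2 g.
  apply: (coset_sum_le_sub sIK) => [|h|h].
  - exact: convolution_summand_left_inv.
  - by rewrite lee_fin mulr_ge0.
  - exists 1%g; first exact: gpred1.
    by rewrite mul1g lee_fin mulrACA divff ?mul1r ?gt_eqF.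
apply: (@le_trans _ _ (l2_energy I f1 xi2)).
  apply: (coset_sum_le_sub sIK) => [h g hI|g|g].
  - by rewrite !(convolution_left_inv xi2 f1I _ hI).
  - by rewrite mule_ge0.
  - exists 1%g; first exact: gpred1.
    by rewrite mul1g mule_self_le// convolution_ge0.
apply: le_trans (RD _ f1I f10 finf1 _ xi2I xi20 xi21) _.
rewrite [(C * _)%:E]EFinM -muleA; apply: lee_wpmul2l; first by rewrite lee_fin ltW.
rewrite [(c * _)%:E]EFinM -muleA.
pose w g := (f g ^+ 2 * (1 + L' g) `^ (2 * s))%:E.
have w0 g : 0 <= w g by rewrite lee_fin mulr_ge0// ?sqr_ge0 ?powR_ge0.
apply: (@le_trans _ _ (coset_sum I (fun g => c%:E * w g))).
  apply: le_coset_sum => g; rewrite -EFinM lee_fin /c /f1 exprMn.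
  rewrite [leRHS]mulrACA; apply: ler_wpM2l; first by rewrite mulr_ge0// sqr_ge0.
  have L'0 : (0 <= 1 + L' g)%R.
    by case: lKL' => l' _; rewrite addr_ge0// (length_ge0 l').
  have L0 : (0 <= 1 + L g)%R.
    by case: lIL => l' _; rewrite addr_ge0// (length_ge0 l').
  rewrite -powRM//; last by rewrite addr_ge0.
  apply: ge0_ler_powR; rewrite ?nnegrE ?(mulr_ge0 _ (ltW s0))//.
  by rewrite mulr_ge0// addr_ge0.
apply: le_trans (coset_sumZ_le _ _ _) _ => //; first exact: ltW.
apply: lee_wpmul2l; first by rewrite lee_fin ltW.
apply: (coset_sum_le_sup idxIK) => // h g hK.
by rewrite /w (double_inv_left fK)// (double_inv_left LK).
Qed.

End FiniteIndexRD.

(** * Finitely supported sums *)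

Section FiniteSums.
Variable R : realType.

(** A sum written with [\sum_(t \in _)] is 0 by convention when its support is infinite; the finite
    set [D] makes both sums agree. *)
Lemma esum_EFin (T : choiceType) (D : set T) (a : T -> R) :
  finite_set D -> (forall t, 0 <= a t) -> (forall t, a t != 0 -> D t) ->
  (\esum_(t in [set: T]) (a t)%:E)%E = (\sum_(t \in [set: T]) a t)%:E.
Proof.
move=> finD a0 aD.
have aD0 t : t \notin D -> a t = 0.
  by move=> tD; apply/eqP; apply: contraNT tD => /aD; rewrite inE.
transitivity (\esum_(t in D) (a t)%:E)%E.
  rewrite [RHS]esum_mkcond; apply: eq_esum => t _.
  by case: ifPn => // /aD0 ->.
rewrite esum_fset//; last by move=> t _; rewrite lee_fin.
rewrite fsumEFin//; congr EFin; apply: fsbig_widen => // t [_ /=].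
by move=> Dt; apply: aD0; rewrite notin_setE.
Qed.

(** This puts sums of different functions over one common finite list, where they can be compared
    term by term. *)
Lemma fsbig_support (V : nmodType) (T : choiceType) (D : set T) (a : T -> V) :
  finite_set D -> (forall t, a t != 0 -> D t) ->
  \sum_(t \in [set: T]) a t = \sum_(t <- finmap.enum_fset (fset_set D)) a t.
Proof.
move=> finD aD; rewrite -fsbig_finite//; apply/esym/fsbig_widen => // t [_ /= Dt].
by apply/eqP; apply: contra_notT Dt => /aD.
Qed.

End FiniteSums.

(** * Reduction of the operator norm to nonnegative functions *)

Section Hecke.
Variables (R : realType) (G : groupType) (H : groupClosed G).
Hypothesis anH : almost_normal H.
Local Notation normc := (@ComplexField.Normc.normc R).

Lemma normc_ge0 (z : R[i]) : 0 <= normc z.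
Proof. by case: z => a b; exact: sqrtr_ge0. Qed.

Lemma normc_real (x : R) : 0 <= x -> normc x%:C%C = x.
Proof. by move=> x0; rewrite /= expr0n addr0 sqrtr_sqr ger0_norm. Qed.

Lemma normc_eq0 (z : R[i]) : (normc z == 0) = (z == 0).
Proof.
apply/eqP/eqP => [/ComplexField.Normc.eq0_normc //|->].
exact: ComplexField.Normc.normc0.
Qed.

Lemma normc_sum_le (T : Type) (r : seq T) (a : T -> R[i]) :
  normc (\sum_(t <- r) a t) <= \sum_(t <- r) normc (a t).
Proof.
elim: r => [|t r IH]; first by rewrite !big_nil ComplexField.Normc.normc0.
by rewrite !big_cons (le_trans (le_normcD _ _))// lerD2l.
Qed.

(** If g r^-1 = a y b with a and b in H, almost normality puts a y in x H for one of finitely many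
    x, and then r lies in H x^-1 g. *)
Lemma finite_rcosets_translate (X : set G) g : finite_set X ->
  finite_set [set c : rcosets H |
    exists2 y, X y & dcoset [set` H] y (g * (repr c)^-1)%g].
Proof.
move=> finX; have /almost_normalP HG := anH.
have [F FP] : {F : G -> set G & forall y, finite_set (F y) /\
    forall k, k \in H -> exists2 x, F y x & (x^-1 * (k * y))%g \in H}.
  apply: (@choice _ _ (fun y F => finite_set F /\
    forall k, k \in H -> exists2 x, F x & (x^-1 * (k * y))%g \in H)) => y.
  by have [F finF FP] := HG y; exists F.
apply: (@sub_finite_set _ _
  (\bigcup_(y in X) [set \pi_(rcosets H)%qT (x^-1 * g)%g | x in F y])).
  move=> c [y Xy [a [b [/= aH bH e]]]]; exists y => //.
  have [_ /(_ a aH)[x Fx xH]] := FP y; exists x => //.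
  apply/esym; rewrite -[LHS]reprK; apply/pi_rcosetP.
  have -> : repr c = ((g * (repr c)^-1)^-1 * g)%g by rewrite invgM invgK mulgVK.
  rewrite e -gpredV !invgM !invgK !mulgA mulgK.
  by rewrite gpredMr// -!mulgA.
apply: bigcup_finite => // y _; apply: finite_image.
by have [] := FP y.
Qed.

Lemma coset_finite_rcosets (f : G -> R) : coset_finite H f ->
  exists2 D : set (rcosets H), finite_set D & forall c, f (repr c) != 0 -> D c.
Proof.
move=> [X finX XP].
(* Inversion exchanges H y H with H y^-1 H, so the case g = 1 of the translation lemma applies to
   the inverses of X. *)
exists [set c : rcosets H | exists2 y, [set x^-1%g | x in X] y &
    dcoset [set` H] y (1 * (repr c)^-1)%g].
  by apply: finite_rcosets_translate; exact: finite_image.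
move=> c /XP[y Xy [a [b [aH bH e]]]]; exists y^-1%g; first by exists y.
exists b^-1%g, a^-1%g; rewrite /= !gpredV mul1g e.
by split=> //; rewrite !invgM mulgA.
Qed.

Lemma coset_finite_translate (f : G -> R) g : coset_finite H f ->
  exists2 D : set (rcosets H), finite_set D &
    forall c, f (g * (repr c)^-1)%g != 0 -> D c.
Proof.
move=> [X finX XP]; eexists; first exact: (finite_rcosets_translate g finX).
by move=> c /XP.
Qed.

Lemma convolutionE (f xi : G -> R) g : coset_finite H f ->
  (forall x, 0 <= f x) -> (forall x, 0 <= xi x) ->
  convolution H f xi g =
  (\sum_(c \in [set: rcosets H]) f (g * (repr c)^-1)%g * xi (repr c))%:E.
Proof.
move=> finf f0 xi0; have [D finD DP] := coset_finite_translate g finf.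
apply: (esum_EFin finD) => [c|c]; first by rewrite mulr_ge0.
by rewrite mulf_eq0 negb_or => /andP[/DP].
Qed.

Lemma weighted_energyE s L (f : G -> R[i]) : coset_finite H (normc \o f) ->
  weighted_energy H s L (normc \o f) = (weighted_norm H s L f ^+ 2)%:E.
Proof.
move=> finf; have [D finD DP] := coset_finite_rcosets finf.
rewrite /weighted_energy /coset_sum (esum_EFin finD).
- rewrite /weighted_norm sqr_sqrtr//.
  by apply: fsumr_ge0 => c _; rewrite mulr_ge0 ?sqr_ge0 ?powR_ge0.
- by move=> c; rewrite mulr_ge0 ?sqr_ge0 ?powR_ge0.
- by move=> c; rewrite mulf_eq0 negb_or sqrf_eq0 => /andP[/DP].
Qed.

Lemma hecke_algebra_coset_finite (f : G -> R[i]) :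
  hecke_algebra H f -> coset_finite H (normc \o f).
Proof.
(* One point is chosen in each of the finitely many double cosets of the support. *)
move=> [_ finf]; exists [set xget 1%g A | A in
    [set dcoset [set` H] g | g in [set g | f g != 0]]].
  exact: finite_image.
move=> x; rewrite /= normc_eq0 => fx.
exists (xget 1%g (dcoset [set` H] x)).
  by exists (dcoset [set` H] x) => //; exists x.
have : dcoset [set` H] x (xget 1%g (dcoset [set` H] x)).
  by apply: xgetPex; exists x; exact: dcoset_refl.
by move=> /eq_dcoset ->; exact: dcoset_refl.
Qed.

Lemma real_hecke_algebra (f : G -> R) : double_inv H f -> coset_finite H f ->
  hecke_algebra H (fun g => (f g)%:C%C).
Proof.
move=> fH [X finX XP]; split; first by move=> h g k hH kH; rewrite fH.
apply: (@sub_finite_set _ _ [set dcoset [set` H] y | y in X]).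
  move=> _ [g /= fg <-].
  have /XP[y Xy yg] : f g != 0 by apply: contra_neq fg => ->.
  by exists y => //; rewrite (eq_dcoset yg).
exact: finite_image.
Qed.

Lemma regular_rep_real (f xi : G -> R) g : coset_finite H f ->
  regular_rep H (fun x => (f x)%:C%C) (fun x => (xi x)%:C%C) g =
  (\sum_(c \in [set: rcosets H]) f (g * (repr c)^-1)%g * xi (repr c))%:C%C.
Proof.
move=> finf; have [D finD DP] := coset_finite_translate g finf.
rewrite /regular_rep !(fsbig_support finD).
- by rewrite rmorph_sum/=; apply: eq_bigr => c _; rewrite rmorphM.
- by move=> c; rewrite mulf_eq0 negb_or => /andP[/DP].
- move=> c; rewrite mulf_eq0 negb_or => /andP[fc _]; apply: DP.
  by apply: contra_neq fc => ->.
Qed.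

Lemma normc_regular_rep_le (f xi : G -> R[i]) g : hecke_algebra H f ->
  ((normc (regular_rep H f xi g))%:E <=
   convolution H (normc \o f) (normc \o xi) g)%E.
Proof.
move=> /hecke_algebra_coset_finite finf.
rewrite convolutionE//; [|by move=> x; exact: normc_ge0..].
have [D finD DP] := coset_finite_translate g finf.
rewrite lee_fin /regular_rep !(fsbig_support finD).
- apply: le_trans (normc_sum_le _ _) _.
  by apply: ler_sum => c _; rewrite /= ComplexField.Normc.normcM.
- by move=> c; rewrite mulf_eq0 negb_or => /andP[/DP].
- move=> c; rewrite mulf_eq0 negb_or => /andP[fc _]; apply: DP.
  by rewrite /= normc_eq0.
Qed.

(** The operator norm bound is evaluated at a real vector of the unit ball, viewed as complex;
    squaring gives the constant [C ^+ 2]. *)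
Lemma has_RD_wrt_positive L : has_RD_wrt H L ->
  exists C s : R, [/\ 0 < C, 0 < s & positive_RD H L C s].
Proof.
move=> [C [s [C0 s0 RD]]]; exists (C ^+ 2), s; split; rewrite ?exprn_gt0//.
move=> f fH f0 finf xi xiH xi0 xi1.
pose fC x := (f x)%:C%C; pose xiC x := (xi x)%:C%C.
have nf : normc \o fC = f by apply/funext => x; exact: normc_real.
have l2xi : l2norm H xiC = sqrte (coset_sum H (fun g => (xi g ^+ 2)%:E)).
  by congr sqrte; apply: eq_esum => c _; rewrite normc_real.
have l2xi1 : (l2norm H xiC <= 1)%E.
  by rewrite l2xi -[leRHS](_ : sqrte 1 = 1)%E ?lee_sqrt//= sqrtr1.
have xiC2 : l2 H xiC.
  split; first by move=> h g hH; rewrite /xiC xiH.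
  by apply: le_lt_trans l2xi1 _; rewrite ltry.
have : (l2norm H (regular_rep H fC xiC) <= (C * weighted_norm H s L fC)%:E)%E.
  apply: le_trans (RD fC (real_hecke_algebra fH finf)).
  by apply: ereal_sup_ubound; exists xiC.
have energyE : l2norm H (regular_rep H fC xiC) = sqrte (l2_energy H f xi).
  congr sqrte; apply: eq_esum => c _.
  rewrite regular_rep_real// convolutionE// normc_real ?EFinM//.
  by apply: fsumr_ge0 => d _; rewrite mulr_ge0.
have W : (weighted_energy H s L f = (weighted_norm H s L fC ^+ 2)%:E).
  by rewrite -[f in LHS]nf weighted_energyE// nf.
rewrite energyE W -EFinM -exprMn => le.
have e0 : (0 <= l2_energy H f xi)%E.
  by apply: coset_sum_ge0 => g; rewrite mule_ge0// convolution_ge0.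
rewrite -(sqr_sqrte e0) EFin_expe lee_sqr//; first exact: sqrte_ge0.
by rewrite lee_fin mulr_ge0// ?sqrtr_ge0// ltW.
Qed.

(** By the triangle inequality, lambda(f)(xi) is bounded pointwise by the convolution of the
    absolute values, while the norms of [f] and [xi] depend only on these. *)
Lemma positive_has_RD_wrt L (C s : R) : 0 < C -> 0 < s ->
  positive_RD H L C s -> has_RD_wrt H L.
Proof.
move=> C0 s0 RD; exists (Num.sqrt C), s; split; rewrite ?sqrtr_gt0//.
move=> f fH; apply: ge_ereal_sup => _ [xi [[xiH _] xi1] <-].
have finf := hecke_algebra_coset_finite fH.
have ab0 (u : G -> R[i]) g : 0 <= (normc \o u) g by exact: normc_ge0.
have nfH : double_inv H (normc \o f).
  by case: fH => fH _ h g k hH kH; rewrite /comp fH.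
have nxiH : left_inv H (normc \o xi) by move=> h g hH; rewrite /comp xiH.
have nxi1 : (coset_sum H (fun g => ((normc \o xi) g ^+ 2)%:E) <= 1)%E.
  rewrite -lee_sqrt//; apply: le_trans xi1 _.
  by rewrite /= sqrtr1.
have := RD _ nfH (ab0 f) finf _ nxiH (ab0 xi) nxi1.
rewrite weighted_energyE// -EFinM => RDf.
rewrite -[weighted_norm _ _ _ _]ger0_norm ?sqrtr_ge0// -sqrtr_sqr -sqrtrM ?(ltW C0)//.
rewrite -[leRHS]/(sqrte (C * weighted_norm H s L f ^+ 2)%:E).
rewrite lee_sqrt; last by rewrite lee_fin mulr_ge0 ?sqr_ge0// ltW.
apply: le_trans RDf; apply: le_esum => c _.
rewrite expr2 EFinM; apply: mule_self_le; first by rewrite lee_fin normc_ge0.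
exact: normc_regular_rep_le.
Qed.

End Hecke.

(** * Rapid decay of G/H and of the pair (G, H) *)

Section Quotient.
Variables (R : realType) (G : groupType) (H : groupClosed G).
Hypothesis nH : normal_subgroup H.
Local Notation Q := (quotient_group nH).
Local Notation T := (@trivial_subgroup Q : groupClosed Q).

Definition quotient_map (x : G) : Q := \pi_Q%qT x.
Local Notation p := quotient_map.

Lemma quotient_mapM x y : p (x * y)%g = (p x * p y)%g.
Proof. exact/esym/(quotient_mulE nH). Qed.

Lemma quotient_mapV x : p x^-1%g = (p x)^-1%g.
Proof. exact/esym/(quotient_invE nH). Qed.

Lemma quotient_mapK (q : Q) : p (repr q) = q.
Proof. exact: reprK. Qed.

Lemma quotient_map1 h : h \in H -> p h = 1%g.
Proof. by move=> hH; apply/(quotient_eqP nH); rewrite invg1 mulg1. Qed.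

(** Thus [f \o repr] is the function induced on G/H, and pulling it back along [p] returns [f]. *)
Lemma left_inv_quotient (V : Type) (f : G -> V) x :
  left_inv H f -> f (repr (p x)) = f x.
Proof. by move=> fH; have [h hH ->] := quotient_reprP nH x; exact: fH. Qed.

Lemma double_inv_quotient_map (V : Type) (f : Q -> V) : double_inv H (f \o p).
Proof.
move=> h g k hH kH.
by rewrite /= !quotient_mapM (quotient_map1 hH) (quotient_map1 kH) mul1g mulg1.
Qed.

Lemma left_inv_trivial (V : Type) (f : Q -> V) : left_inv T f.
Proof. by move=> h g /eqP ->; rewrite mul1g. Qed.

Lemma double_inv_trivial (V : Type) (f : Q -> V) : double_inv T f.
Proof. by move=> h g k /eqP -> /eqP ->; rewrite mul1g mulg1. Qed.

Lemma dcoset_trivial (x y : Q) : dcoset [set` T] x y -> y = x.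
Proof. by move=> [a [b [/= /eqP -> /eqP -> ->]]]; rewrite mul1g mulg1. Qed.

Lemma almost_normal_trivial : almost_normal T.
Proof.
apply/almost_normalP => g; exists [set g]; first exact: finite_set1.
by move=> k /eqP ->; exists g; rewrite // mul1g mulVg gpred1.
Qed.

Lemma almost_normal_normal : almost_normal H.
Proof.
apply/almost_normalP => g; exists [set g]; first exact: finite_set1.
move=> k kH; exists g => //.
by have := nH g^-1%g kH; rewrite invgK mulgA.
Qed.

(** Cosets of the trivial subgroup form a type distinct from [Q], and [repr] is a bijection between
    them; [Q] itself has the carrier [rcosets H]. *)
Lemma coset_sum_quotient (phi : Q -> \bar R) :
  coset_sum T phi = coset_sum H (phi \o p).
Proof.
have bij : set_bij [set: rcosets T] [set: Q] (fun c => repr c).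
  split => //; first by move=> c d _ _ e; rewrite -[c]reprK e reprK.
  move=> q _; exists (\pi_(rcosets T)%qT q) => //.
  exact: (left_inv_repr q (@left_inv_trivial _ id)).
rewrite /coset_sum -(reindex_esum _ _ _ _ bij).
by apply: eq_esum => c _; rewrite /= quotient_mapK.
Qed.

Lemma convolution_quotient (f xi : Q -> R) g :
  convolution H (f \o p) (xi \o p) g = convolution T f xi (p g).
Proof.
rewrite /convolution coset_sum_quotient; apply: eq_coset_sum => h /=.
by rewrite quotient_mapM quotient_mapV.
Qed.

Lemma l2_energy_quotient (f xi : Q -> R) :
  l2_energy T f xi = l2_energy H (f \o p) (xi \o p).
Proof.
rewrite /l2_energy coset_sum_quotient; apply: eq_coset_sum => g /=.
by rewrite convolution_quotient.
Qed.

Lemma coset_finite_quotient (f : Q -> R) :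
  coset_finite T f <-> coset_finite H (f \o p).
Proof.
split=> -[X finX XP].
  exists [set repr y | y in X]; first exact: finite_image.
  move=> x /XP[y Xy /dcoset_trivial xy]; exists (repr y); first by exists y.
  exists (x * (repr y)^-1)%g, 1%g; split; rewrite /= ?gpred1//.
    by apply/(quotient_eqP nH); rewrite -/(p x) xy -/(p (repr y)) quotient_mapK.
  by rewrite mulg1 mulgVK.
exists [set p y | y in X]; first exact: finite_image.
move=> q fq; have [|y Xy [a [b [/= aH bH e]]]] := XP (repr q).
  by rewrite /= quotient_mapK.
exists (p y); first by exists y.
rewrite -[q]quotient_mapK e !quotient_mapM (quotient_map1 aH) (quotient_map1 bH).
by rewrite mul1g mulg1; exact: dcoset_refl.
Qed.

(** Pullback along [p] identifies functions on [Q] with left H-invariant functions on G and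
    preserves energies, norms and finiteness of support. *)
Lemma positive_RD_quotient (L : Q -> R) C s :
  positive_RD T L C s <-> positive_RD H (L \o p) C s.
Proof.
split=> RD f fH f0 finf xi xiH xi0 xi1.
  have fE : (f \o repr) \o p = f.
    by apply/funext => x; exact: left_inv_quotient (double_inv_left fH).
  have xiE : (xi \o repr) \o p = xi.
    by apply/funext => x; exact: left_inv_quotient xiH.
  rewrite -fE -xiE -l2_energy_quotient.
  rewrite (_ : weighted_energy H s (L \o p) _ = weighted_energy T s L (f \o repr)).
    apply: RD => [|q||||]; rewrite ?f0//.
    - exact: double_inv_trivial.
    - by apply/coset_finite_quotient; rewrite fE.
    - exact: left_inv_trivial.
    - by move=> q; exact: xi0.
    - rewrite coset_sum_quotient; apply: le_trans xi1; rewrite le_eqVlt.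
      apply/orP; left; apply/eqP; apply: eq_coset_sum => g.
      by rewrite -[in RHS]xiE.
  by rewrite /weighted_energy coset_sum_quotient.
rewrite l2_energy_quotient /weighted_energy coset_sum_quotient.
apply: RD => [|g||||]; rewrite ?f0//.
- exact: double_inv_quotient_map.
- exact/coset_finite_quotient.
- exact/double_inv_left/double_inv_quotient_map.
- by move=> g; exact: xi0.
- by move: xi1; rewrite coset_sum_quotient.
Qed.

Lemma length_on_pair_quotient (L : Q -> R) :
  length_on_pair T L <-> length_on_pair H (L \o p).
Proof.
split=> -[lL LH].
  split; last by move=> h /= hH; rewrite /length_kernel /= quotient_map1// (length1 lL).
  split => [g||g|g h] /=.
  - exact: length_ge0.
  - by rewrite quotient_map1 ?gpred1// (length1 lL).
  - by rewrite quotient_mapV (lengthV lL).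
  - by rewrite quotient_mapM (lengthM lL).
have L1 : L 1%g = 0.
  by rewrite -(quotient_map1 (gpred1 : 1%g \in H)); exact: (length1 lL).
split; last by move=> h /= /eqP ->.
split => // [q|q|q r].
- by rewrite -[q]quotient_mapK; exact: (length_ge0 lL).
- by rewrite -[q]quotient_mapK -quotient_mapV; exact: (lengthV lL).
- by rewrite -[q]quotient_mapK -[r]quotient_mapK -quotient_mapM; exact: (lengthM lL).
Qed.

Lemma group_has_RD_quotient : group_has_RD R Q <-> pair_has_RD R H.
Proof.
split=> -[_ [L [lL /has_RD_wrt_positive RD]]].
  have [C [s [C0 s0 RDp]]] := RD almost_normal_trivial.
  split; first exact: almost_normal_normal.
  exists (L \o p); split; first exact/length_on_pair_quotient.
  apply: (positive_has_RD_wrt almost_normal_normal C0 s0).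
  exact/positive_RD_quotient.
have [C [s [C0 s0 RDp]]] := RD almost_normal_normal.
split; first exact: almost_normal_trivial.
have LE : (L \o repr) \o p = L.
  apply/funext => x; apply: left_inv_quotient.
  exact/double_inv_left/length_double_inv.
exists (L \o repr); split; first by apply/length_on_pair_quotient; rewrite LE.
apply: (positive_has_RD_wrt almost_normal_trivial C0 s0).
by apply/positive_RD_quotient; rewrite LE.
Qed.

End Quotient.

(** * Commensurability and the intersection of H and K *)

Section Commensurability.
Variable G : groupType.
Implicit Types (H K : groupClosed G).

Lemma pair_has_RD_finite_index (R : realType) (I K : groupClosed G) n :
  {subset I <= K} -> index_le I K n -> pair_has_RD R I <-> pair_has_RD R K.
Proof.
move=> sIK idxIK; split=> -[an [L [lL /has_RD_wrt_positive RD]]].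
  have [C [s [C0 s0 RDp]]] := RD an.
  have anK := almost_normal_sup sIK idxIK an.
  have [L' [C' [C'0 lL' RDK]]] := positive_RD_sup sIK idxIK C0 s0 lL RDp.
  split=> //; exists L'; split=> //; exact: positive_has_RD_wrt RDK.
have [C [s [C0 s0 RDp]]] := RD an.
have anI := almost_normal_sub sIK idxIK an.
have RDI := positive_RD_sub sIK idxIK (ltW C0) lL RDp.
split=> //; exists L; split; last first.
  by apply: positive_has_RD_wrt RDI => //; rewrite mulr_gt0// exprn_gt0// ltr0n.
case: lL => lL LK; split=> // h /= hI; apply: LK; exact: sIK.
Qed.

Definition subgroup_meet H K : {pred G} := [pred x | (x \in H) && (x \in K)].

Section SubgroupMeet.
Variables H K : groupClosed G.

Lemma subgroup_meetM : mulg_closed (subgroup_meet H K).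
Proof.
move=> x y /andP[xH xK] /andP[yH yK].
by apply/andP; split; apply: gpredM.
Qed.

Lemma subgroup_meet1 : 1%g \in subgroup_meet H K.
Proof. by apply/andP; split; apply: gpred1. Qed.

Lemma subgroup_meetV : invg_closed (subgroup_meet H K).
Proof. by move=> x /andP[xH xK]; apply/andP; split; rewrite gpredV. Qed.

HB.instance Definition _ :=
  isMulClosed.Build G (subgroup_meet H K) subgroup_meetM.
HB.instance Definition _ :=
  isMul1Closed.Build G (subgroup_meet H K) subgroup_meet1.
HB.instance Definition _ :=
  isInvClosed.Build G (subgroup_meet H K) subgroup_meetV.

End SubgroupMeet.

Lemma finite_index_transversal (A B : set G) : A 1%g -> B 1%g -> finite_index A B ->
  exists n (t : 'I_n.+1 -> G),
    (forall i, B (t i)) /\ forall b, B b -> exists i, A ((t i)^-1 * b)%g.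
Proof.
move=> A1 B1 /(finite_image (fun S => xget 1%g [set b | B b /\ lcoset b A = S])).
(* [r] lists one chosen element of B per coset; the 1 in front makes the list have length
   [(size r).+1]. *)
move=> /finite_seqP[r rE]; exists (size r), (fun i => nth 1%g (1%g :: r) i).
have rP x : x \in r -> exists2 b, B b &
    x = xget 1%g [set b' | B b' /\ lcoset b' A = lcoset b A].
  move=> xr; have : [set` r] x by [].
  by rewrite -rE => -[_ [b Bb <-] <-]; exists b.
split=> [i|b Bb].
  have [->//|/rP[b Bb ->]] : nth 1%g (1%g :: r) i = 1%g \/ nth 1%g (1%g :: r) i \in r.
    by case: i => -[|i] ir; [left | right; apply: mem_nth].
  have [|//] := @xgetPex _ 1%g [set b' | B b' /\ lcoset b' A = lcoset b A].
  by exists b.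
pose x := xget 1%g [set b' | B b' /\ lcoset b' A = lcoset b A].
have [Bx xb] : B x /\ lcoset x A = lcoset b A.
  by apply: (@xgetPex _ 1%g [set b' | B b' /\ lcoset b' A = lcoset b A]); exists b.
have xr : x \in r.
  suff : [set` r] x by [].
  by rewrite -rE; exists (lcoset b A) => //; exists b.
have ir : (index x (1%g :: r) < (size r).+1)%N by rewrite index_mem inE xr orbT.
exists (Ordinal ir); rewrite /= nth_index ?inE ?xr ?orbT//.
have : lcoset x A b by rewrite xb; exists 1%g => //; rewrite mulg1.
by move=> [a Aa <-]; rewrite mulKg.
Qed.

(** Conjugation by [g^-1] fixes the normal subgroup H and carries g K g^-1 to K, so conjugating the
    two transversals gives transversals for the intersection of H and K. *)
Lemma commensurable_meet H K : normal_subgroup H -> commensurable H K ->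
  (exists n, index_le (subgroup_meet H K) H n) /\
  (exists n, index_le (subgroup_meet H K) K n).
Proof.
move=> nH [g [/= finH finK]].
have conjH x : x \in H -> (g^-1 * x * g)%g \in H.
  by move=> xH; have := nH g^-1%g x xH; rewrite invgK.
have meetP x : ([set` H] `&` conj_set g [set` K]) x ->
    (g^-1 * x * g)%g \in subgroup_meet H K.
  move=> [/= xH [k /= kK e]]; apply/andP; split; first exact: conjH.
  by rewrite -e !mulgA mulVg mul1g mulgVK.
have meet1 : ([set` H] `&` conj_set g [set` K]) 1%g.
  split; first exact: gpred1.
  by exists 1%g; [exact: gpred1 | rewrite mulg1 mulgV].
have conjE x b : ((g^-1 * x * g)^-1 * b = g^-1 * (x^-1 * (g * b * g^-1)) * g)%g.
  by rewrite !invgM invgK !mulgA mulgVK.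
split.
  have [|n [t [tH tP]]] := finite_index_transversal meet1 _ finH.
    exact: gpred1.
  exists n, (fun i => g^-1 * t i * g)%g; split=> [i|b bH].
    exact/conjH/tH.
  have [|i ti] := tP (g * b * g^-1)%g; first exact: nH.
  by exists i; rewrite conjE; exact: meetP.
have [|n [t [tK tP]]] := finite_index_transversal meet1 _ finK.
  by case: meet1.
exists n, (fun i => g^-1 * t i * g)%g; split=> [i|b bK].
  by have [k /= kK <-] := tK i; rewrite !mulgA mulVg mul1g mulgVK.
have [|i ti] := tP (g * b * g^-1)%g; first by exists b.
by exists i; rewrite conjE; exact: meetP.
Qed.

End Commensurability.

Theorem corollary2p5 (R : realType) (G : groupType) (H K : groupClosed G)
  (commHK : commensurable H K) (nH : normal_subgroup H) :
  group_has_RD R (quotient_group nH) <-> pair_has_RD R K.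
Proof.
have [[n idxH] [m idxK]] := commensurable_meet nH commHK.
(* (RD) passes from G/H to (G, H), down to the intersection with K, and up to (G, K). *)
rewrite group_has_RD_quotient.
rewrite -(pair_has_RD_finite_index R _ idxH); last by move=> x /andP[].
by apply: pair_has_RD_finite_index idxK => x /andP[].
Qed.
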